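(* Let $\delta\ge 2$ and $\eta\ge 0$ be integers, let $0<\lambda\le 2^{-9\delta}\delta^{-1-\eta}$, let $\tau=\delta^{1+\eta}$, and let $\epsilon>0$. Let $G$ be an $\epsilon$-coherent graph with an equicardinal blockade $\mathcal{B}$ of length at least $6\delta^{\eta+2}$ and width at least $2^{9\delta}\epsilon|G|$, such that $\mathcal{B}$ is $\lambda$-concave, $\tau$-support-uniform and $(2^{-9\delta},\tau)$-support-invariant. Then $G$ contains $T(\delta,\eta)$.
   Context: All graphs are finite and simple; $|G|$ is the number of vertices; $G$ contains $H$ if some induced subgraph of $G$ is isomorphic to $H$. For $\epsilon>0$, $G$ is $\epsilon$-coherent if $|G|>1$, every vertex has degree less than $\epsilon|G|$, and there do not exist disjoint sets $A,B\subseteq V(G)$ with $|A|,|B|\ge\epsilon|G|$ and no edges between $A$ and $B$. Blockades: a blockade in $G$ is a sequence $\mathcal{B}=(B_i:i\in I)$ of pairwise disjoint nonempty subsets of $V(G)$ (blocks), $I$ a finite set of integers; its length is $|I|$, its width is $\min_i|B_i|$; it is equicardinal if all blocks have the same cardinality. A contraction of $\mathcal{B}$ is a blockade $(B_i':i\in I)$ with $\emptyset\ne B_i'\subseteq B_i$ for all $i$. $V(\mathcal{B})$ denotes the union of the blocks. An induced subgraph $H$ of $G$ is $\mathcal{B}$-rainbow if each vertex of $H$ lies in some block and no two lie in the same block; its support is the set of $i\in I$ with $V(H)\cap B_i\neq\emptyset$. The $\mathcal{B}$-ordering of a $\mathcal{B}$-rainbow $H$ is the linear order on $V(H)$ with $u<v$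 if $u\in B_i$, $v\in B_j$, $i<j$. An ordered graph is a graph with a linear order of its vertex set; a $\mathcal{B}$-rainbow $H$ is a copy of an ordered graph $J$ if $H$ with its $\mathcal{B}$-ordering is isomorphic to $J$ as ordered graphs. The trace of an ordered graph $J$ relative to $\mathcal{B}$ is the set of supports of all $\mathcal{B}$-rainbow copies of $J$. For an integer $\tau\ge1$, $\mathcal{B}$ is $\tau$-support-uniform if for every ordered tree $J$ with $|J|\le\tau$, the trace of $J$ relative to $\mathcal{B}$ is either empty or consists of all subsets of $I$ of cardinality $|J|$. For $0<\kappa\le1$, $\mathcal{B}$ is $(\kappa,\tau)$-support-invariant if for every contraction $\mathcal{B}'$ of $\mathcal{B}$ of width at least $\kappa$ times the width of $\mathcal{B}$, and every ordered tree $J$ with $|J|\le\tau$, the trace of $J$ relative to $\mathcal{B}$ equals the trace of $J$ relative to $\mathcal{B}'$. Concavity: let $\mathcal{B}=(B_i:i\in I)$ be equicardinal of width $w$ and $0\le\lambda\le 1/2$. A set $X\subseteq V(G)\setminus B_i$ $\lambda$-covers $B_i$ if at least $\lambda w$ vertices of $B_i$ have a neighbour in $X$, and $\lambda$-misses $B_i$ if at least $\lambda w$ vertices of $B_i$ have no neighbour in $X$. $\mathcal{B}$ is $\lambda$-concave if there do not exist $h_1<h_2<h_3$ in $I$ and $X\subseteq V(\mathcal{B})\setminus(B_{h_1}\cup B_{h_2}\cup B_{h_3})$ such that $X$ $\lambda$-covers $B_{h_2}$ and $\lambda$-misses both $B_{h_1}$ and $B_{h_3}$. Trees: for integer $\delta\ge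 2$, $T(\delta,0)$ is the one-vertex tree; for $\eta\ge1$, $T(\delta,\eta)$ is the rooted tree obtained from the disjoint union of $\delta$ copies of $T(\delta,\eta-1)$ by adding a new vertex adjacent to their roots and making it the root (equivalently: the root has degree $\delta$, every other vertex has degree $\delta+1$ or $1$, and every leaf is at distance exactly $\eta$ from the root). *)

(* Defs.v *)
From HB Require Import structures.
From mathcomp Require Import all_boot all_order all_algebra.
Set Implicit Arguments. Unset Strict Implicit. Unset Printing Implicit Defensive.
Import Order.TTheory GRing.Theory Num.Theory.

Section GraphDefs.
Variable T : finType.
Variable e : rel T.

Definition simple_graph : Prop := symmetric e /\ irreflexive e.

Local Open Scope ring_scope.

Definition coherent (R : realFieldType) (eps : R) : Prop :=
  (1 < #|T|)%N /\
  (forall v : T, #|[set u | e v u]|%:R < eps * #|T|%:R) /\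
  ~ (exists A B : {set T},
        [disjoint A & B] /\ eps * #|T|%:R <= #|A|%:R /\ eps * #|T|%:R <= #|B|%:R /\
        (forall a b, a \in A -> b \in B -> ~~ e a b)).

(* A blockade: index set I (a finite set of integers, given as a duplicate-free
   list), blocks B i for i in I. *)
Definition blockade (I : seq int) (B : int -> {set T}) : Prop :=
  uniq I /\ (forall i, i \in I -> B i != set0) /\
  (forall i j, i \in I -> j \in I -> i != j -> [disjoint B i & B j]).

Definition width (I : seq int) (B : int -> {set T}) : nat :=
  match I with
  | [::] => 0%N
  | i0 :: I' => foldr (fun i m => minn #|B i| m) #|B i0| I'
  end.

Definition equicardinal (I : seq int) (B : int -> {set T}) : Prop :=
  forall i j, i \in I -> j \in I -> #|B i| = #|B j|.

Definition contraction (I : seq int) (B' B : int -> {set T}) : Prop :=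
  forall i, i \in I -> B' i \subset B i /\ B' i != set0.

Definition Vblock (I : seq int) (B : int -> {set T}) : {set T} :=
  \bigcup_(i <- I) B i.

(* ordered graphs on {0,..,k-1} with the natural order; ordered trees *)
Definition ordered_tree (k : nat) (J : rel 'I_k) : Prop :=
  (0 < k)%N /\ symmetric J /\ irreflexive J /\
  (forall x y, connect J x y) /\
  ~ (exists c : seq 'I_k, (3 <= size c)%N /\ uniq c /\ cycle J c).

(* f, g describe a B-rainbow induced subgraph which is a copy of the ordered
   graph J: vertex i of J goes to f i, lying in block B (g i); the B-ordering
   agrees with the order of J iff g is strictly increasing. *)
Definition rainbow_copy (I : seq int) (B : int -> {set T}) (k : nat) (J : rel 'I_k)
  (f : 'I_k -> T) (g : 'I_k -> int) : Prop :=
  (forall i, g i \in I) /\ (forall i, f i \in B (g i)) /\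
  (forall i j : 'I_k, (i < j)%N -> g i < g j) /\
  (forall i j : 'I_k, i != j -> e (f i) (f j) = J i j).

Definition in_trace (I : seq int) (B : int -> {set T}) (k : nat) (J : rel 'I_k)
  (S : seq int) : Prop :=
  exists f g, rainbow_copy I B J f g /\ (forall x, x \in S <-> exists i, g i = x).

Definition support_uniform (tau : nat) (I : seq int) (B : int -> {set T}) : Prop :=
  forall (k : nat) (J : rel 'I_k), ordered_tree J -> (k <= tau)%N ->
    (forall S, ~ in_trace I B J S) \/
    (forall S : seq int, uniq S -> {subset S <= I} -> size S = k -> in_trace I B J S).

Definition support_invariant (R : realFieldType) (kappa : R) (tau : nat)
  (I : seq int) (B : int -> {set T}) : Prop :=
  forall B' : int -> {set T}, contraction I B' B ->
    kappa * (width I B)%:R <= (width I B')%:R ->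
    forall (k : nat) (J : rel 'I_k), ordered_tree J -> (k <= tau)%N ->
      forall S : seq int, in_trace I B J S <-> in_trace I B' J S.

(* lambda-concavity (for an equicardinal blockade of width w = width I B) *)
Definition lcovers (R : realFieldType) (lam : R) (I : seq int) (B : int -> {set T})
  (X : {set T}) (i : int) : Prop :=
  [disjoint X & B i] /\
  lam * (width I B)%:R <= #|[set v in B i | [exists x in X, e v x]]|%:R.

Definition lmisses (R : realFieldType) (lam : R) (I : seq int) (B : int -> {set T})
  (X : {set T}) (i : int) : Prop :=
  [disjoint X & B i] /\
  lam * (width I B)%:R <= #|[set v in B i | [forall x in X, ~~ e v x]]|%:R.

Definition concave (R : realFieldType) (lam : R) (I : seq int) (B : int -> {set T}) : Prop :=
  ~ (exists (h1 h2 h3 : int) (X : {set T}),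
       [/\ h1 \in I, h2 \in I & h3 \in I] /\ h1 < h2 /\ h2 < h3 /\
       X \subset Vblock I B :\: (B h1 :|: B h2 :|: B h3) /\
       lcovers lam I B X h2 /\ lmisses lam I B X h1 /\ lmisses lam I B X h3).

End GraphDefs.

(* The tree T(d,h): vertices are sequences over {0..d-1} of length <= h
   (root = empty sequence); a vertex is adjacent to its one-letter extensions. *)
Definition Tvert (d h : nat) := {k : 'I_h.+1 & k.-tuple 'I_d}.

Definition Tchild (d h : nat) (u v : Tvert d h) : bool :=
  (size (tagged v) == (size (tagged u)).+1) &&
  (take (size (tagged u)) (tagged v : seq 'I_d) == (tagged u : seq 'I_d)).

Definition Tadj (d h : nat) : rel (Tvert d h) :=
  fun u v => Tchild u v || Tchild v u.

Definition contains_T (T : finType) (e : rel T) (d h : nat) : Prop :=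
  exists f : Tvert d h -> T, injective f /\ forall x y, e (f x) (f y) = Tadj x y.

(* Main.v *)
Require Import Defs.
From HB Require Import structures.
From mathcomp Require Import all_boot all_order all_algebra.
From mathcomp Require Import zify.
Set Implicit Arguments. Unset Strict Implicit. Unset Printing Implicit Defensive.
Import Order.TTheory GRing.Theory Num.Theory.

(** Filter [T(d, h)] by trees [S_0, ..., S_(d h)], each obtained from the previous one by making
one more branch at the root one level taller.  Keep a rainbow copy of [S_a] whose root comes first
and one of [S_b] whose root comes last, and increase [a] or [b] as long as both are below [d h].

For this take four families of about [w / 2] disjoint copies each, every family with a constant
support (uniformity and invariance): two families of [S_a] and two of [S_b], placed so that the
roots are the outermost vertices.  A set of copies in one family that leaves part of the two
outermost foreign roots uncovered touches, by concavity, almost nothing else.  If every contact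
between two copies involved, for one of them, a foreign vertex other than an outermost root, then
deleting greedily the copies for which at least a third of the current contacts are of this kind
would delete few copies, and counting the contacts that remain gives a contradiction.  So some two
copies are joined by a single edge, between their roots, and together contain the next tree. *)

(** * Counting contacts *)

(** [gam] sorts the items into families because the bound [m] on bad contacts is only available for
    one family at a time. It allows one extra item [x], so that a greedy step can be tested before
    the contacts of the enlarged set are known to be at most [M]. *)
Lemma no_bad_orientation (X G : finType) (gam : X -> G) (touch bad : rel X) (m M : nat) :
  let N (Y : {set X}) := [set y | [exists x in Y, touch x y]] in
  let bc (Y : {set X}) g := [set y | [exists x in Y, (gam x == g) && bad x y]] in
  symmetric touch -> (forall x y, bad x y -> touch x y) ->
  (forall x y, touch x y -> bad x y || bad y x) ->
  3 * (#|G| * m) <= M ->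
  (forall Y x g, #|N Y| <= M -> #|bc (x |: Y) g| <= m) ->
  (forall Y, #|N Y| <= M -> #|Y| + #|N Y| < #|X|) ->
  False.
Proof.
move=> N bc tS bT tB leM small big.
pose good (Y : {set X}) := (#|N Y| <= 3 * \sum_g #|bc Y g|) && (#|N Y| <= M).
have N0 : N set0 = set0.
  by apply/setP=> y; rewrite !inE; apply/negbTE/negP=> /existsP[x]; rewrite inE.
have good0 : good set0 by rewrite /good N0 cards0 !leq0n.
have [Y /maxsetP[/andP[Y1 Y2] Ymax] _] := maxset_exists good0.
pose F := ~: (Y :|: N Y).
have Fx : 0 < #|F|.
  have := cardsC (Y :|: N Y); rewrite -/F; have := cardsU Y (N Y).
  by have := big Y Y2; lia.
(* Otherwise [x |: Y] would be good too, against maximality. The contacts of [x] inside [F] are new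
   for [Y], so the ratio 3 survives, and [small] bounds all contacts by [3 * (#|G| * m) <= M]. *)
have key x : x \in F ->
   3 * #|[set y in F | bad x y]| < #|[set y in F | touch x y]|.
  move=> xF; rewrite ltnNge; apply/negP=> H.
  have xY : x \notin Y by move: xF; rewrite !inE; case: (x \in Y).
  have xN : forall y, y \in Y -> ~~ touch x y.
    move=> y yY; apply/negP=> txy; move: xF; rewrite !inE negb_or => /andP[_].
    by move/negP; apply; apply/existsP; exists y; rewrite yY tS.
  have NE : #|N (x |: Y)| = #|N Y| + #|[set y in F | touch x y]|.
    rewrite -cardsUI -[LHS]addn0; congr (_ + _).
      apply: eq_card=> y; rewrite !inE; apply/existsP/idP.
        case=> z; rewrite !inE => /andP[/orP[/eqP->|zY] tz].
          case: (boolP [exists z in Y, touch z y]) => [//|ny].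
          rewrite tz orbF andbT; apply/orP; right; apply/negP=> yY.
          by move: (xN _ yY); rewrite tz.
        by apply/orP; left; apply/existsP; exists z; rewrite zY.
      case/orP=> [/existsP[z /andP[zY tz]]|/andP[_ tz]].
        by exists z; rewrite !inE zY orbT.
      by exists x; rewrite !inE eqxx.
    apply/esym/eqP; rewrite cards_eq0; apply/eqP/setP=> y; rewrite !inE.
    by case: [exists z in Y, touch z y] => //=; rewrite orbT.
  have BE : \sum_g #|bc Y g| + #|[set y in F | bad x y]| <= \sum_g #|bc (x |: Y) g|.
    rewrite (bigD1 (gam x)) //= [X in _ <= X](bigD1 (gam x)) //=.
    rewrite addnAC leq_add //.
      rewrite -cardsUI; set I0 := _ :&: _.
      have -> : I0 = set0.
        apply/setP=> y; rewrite !inE; apply/negP=> /andP[/existsP[z /andP[zY /andP[_ bz]]]].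
        move=> /andP[/negP h _]; apply: h; apply/orP; right; apply/existsP; exists z.
        by rewrite zY bT.
      rewrite cards0 addn0; apply/subset_leq_card/subsetP=> y; rewrite !inE.
      case/orP=> [/existsP[z /andP[zY H1]]|/andP[_ H1]]; apply/existsP.
        by exists z; rewrite !inE zY orbT.
      by exists x; rewrite !inE !eqxx.
    apply: leq_sum=> g _; apply/subset_leq_card/subsetP=> y; rewrite !inE.
    by case/existsP=> z /andP[zY H1]; apply/existsP; exists z; rewrite !inE zY orbT.
  have G1 : #|N (x |: Y)| <= 3 * \sum_g #|bc (x |: Y) g| by lia.
  have G2 : \sum_g #|bc (x |: Y) g| <= #|G| * m.
    rewrite -sum_nat_const; apply: leq_sum=> g _; exact: small.
  have : good (x |: Y) by rewrite /good G1 /=; lia.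
  move/Ymax => /(_ (subsetUr _ _)) E.
  by move: xY; rewrite -E !inE eqxx.
have cE (r : rel X) x : #|[set y in F | r x y]| = \sum_(y in F) r x y.
  rewrite -sum1_card big_mkcond /= [RHS]big_mkcond /=; apply: eq_bigr=> y _.
  by rewrite inE; case: (y \in F) => //=; case: (r x y).
(* Double counting in [F]: by [key] the contacts exceed three times the bad ones, but each contact
   is bad in some direction, so they are at most twice the bad ones. *)
have S1 : \sum_(x in F) (3 * #|[set y in F | bad x y]|).+1
          <= \sum_(x in F) #|[set y in F | touch x y]|.
  by apply: leq_sum=> x /key.
have S2 : \sum_(x in F) #|[set y in F | touch x y]|
   <= \sum_(x in F) \sum_(y in F) bad x y + \sum_(x in F) \sum_(y in F) bad y x.
  rewrite -big_split /=; apply: leq_sum=> x _; rewrite cE -big_split /=.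
  apply: leq_sum=> y _; case: (boolP (touch x y)) => // /tB.
  by case: (bad x y); case: (bad y x).
rewrite [X in _ + X]exchange_big /= in S2.
have S3 : \sum_(x in F) (3 * #|[set y in F | bad x y]|).+1 =
   3 * (\sum_(x in F) \sum_(y in F) bad x y) + #|F|.
  under eq_bigr do rewrite -addn1 cE.
  by rewrite big_split /= -big_distrr /= sum1_card.
by move: S1 S2; rewrite S3; lia.
Qed.

(** * The trees *)

Definition child (s t : seq nat) := (size t == (size s).+1) && (take (size s) t == s).
Definition adj (s t : seq nat) := child s t || child t s.

Lemma adj_sym : symmetric adj.
Proof. by move=> s t; rewrite /adj orbC. Qed.

Lemma adj_irr : irreflexive adj.
Proof. by move=> s; rewrite /adj orbb /child; apply/negbTE/negP; lia. Qed.

Lemma adj_cons x s y t : adj (x :: s) (y :: t) = (x == y) && adj s t.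
Proof.
by rewrite /adj /child /= !eqseq_cons !eqSS [y == x]eq_sym; case: (x == y) => /=; rewrite ?andbF.
Qed.

Lemma adj_nil x s : adj [::] (x :: s) = (s == [::]).
Proof. by rewrite /adj /child /= eqxx andbT orbF eqSS size_eq0. Qed.

Lemma child_uniq s s' t : child s t -> child s' t -> s = s'.
Proof.
move=> /andP[/eqP h1 /eqP h2] /andP[/eqP h3 /eqP h4].
have E : size s = size s' by lia.
by rewrite -h2 -h4 E.
Qed.

Fixpoint words (d h : nat) : seq (seq nat) :=
  if h is h'.+1 then [::] :: [seq i :: s | i <- iota 0 d, s <- words d h'] else [:: [::]].

Lemma mem_words d h s : (s \in words d h) = all (fun i => i < d) s && (size s <= h).
Proof.
elim: h s => [|h IH] [|x s] //=.
  by rewrite inE /= andbF.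
rewrite inE /=; apply/allpairsP/idP.
  by case=> -[i t] /= [hi]; rewrite mem_iota in hi; rewrite IH => /andP[h1 h2] [-> ->]; rewrite h1 ltnS h2 !andbT; lia.
move=> /andP[/andP[h1 h2] h3]; exists (x, s); split => //=; first by rewrite mem_iota.
by rewrite IH h2.
Qed.

Lemma uniq_words d h : uniq (words d h).
Proof.
elim: h => [|h IH] //=; apply/andP; split.
  by apply/negP=> /allpairsP[[i s] [_ _]].
by apply: allpairs_uniq => //; [exact: iota_uniq | move=> [a b] [a' b'] _ _ /= [-> ->]].
Qed.

Lemma size_words d h : 1 < d -> size (words d h) < d ^ h.+1.
Proof.
move=> d2; elim: h => [|h IH] /=; first by rewrite expn1.
rewrite size_allpairs size_iota expnS; nia.
Qed.

(* [S_a] with [a = d * z + m], [m < d]: the root has [m] branches [T(d, z)] and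
   [d - m] branches [T(d, z - 1)], so that [S_(d * z)] is [T(d, z)]. *)
Definition inS (d a : nat) (s : seq nat) :=
  all (fun i => i < d) s && (if s is x :: t then size t * d + x < a else true).

Definition Slist d h a := [seq s <- words d h | inS d a s].

Lemma uniq_Slist d h a : uniq (Slist d h a).
Proof. exact/filter_uniq/uniq_words. Qed.

Lemma size_Slist d h a : 1 < d -> size (Slist d h a) < d ^ h.+1.
Proof.
move=> d2; apply: leq_ltn_trans (size_words h d2).
by rewrite size_filter count_size.
Qed.

Lemma mem_Slist d h a s : a <= d * h -> (s \in Slist d h a) = inS d a s.
Proof.
move=> ah; rewrite mem_filter mem_words andbC.
case: (boolP (inS d a s)) => [|_]; last by rewrite andbF.
case/andP=> -> /=; case: s => [|x s] //= H; rewrite andbT; nia.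
Qed.

Lemma nil_Slist d h a : [::] \in Slist d h a.
Proof. by rewrite mem_filter mem_words. Qed.

Lemma Slist_full d h s : all (fun i => i < d) s -> size s <= h -> s \in Slist d h (d * h).
Proof.
move=> h1 h2; rewrite mem_filter mem_words h1 h2 /inS h1 /= andbT.
by case: s h1 h2 => [|x s] //= /andP[h1 _] h2; nia.
Qed.

Lemma Slist0 d h s : s \in Slist d h 0 -> s = [::].
Proof. by rewrite mem_filter /inS; case: s => [|x s] //=; rewrite ltn0 andbF. Qed.

Lemma take_inS d a n s : inS d a s -> inS d a (take n s).
Proof.
case: s n => [|x s] [|n] //= /andP[/andP[h1 h2] h3]; rewrite /inS /= h1 /=.
apply/andP; split; last by have := size_take_min n s; nia.
by apply/allP=> y /mem_take; move/allP: h2; apply.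
Qed.

(** The set of words is closed under prefixes, so shortening leads from any word to the root. On a
    cycle, both neighbours of a longest word would be its parent, hence equal. *)
Lemma ordered_tree_Slist d h a (L : seq (seq nat)) : L =i Slist d h a -> uniq L ->
  ordered_tree (fun i j : 'I_(size L) => adj (nth [::] L i) (nth [::] L j)).
Proof.
move=> LE uL; set J := (fun i j : 'I__ => _).
have L0 : [::] \in L by rewrite LE nil_Slist.
have ki : index [::] L < size L by rewrite index_mem.
pose r := Ordinal ki.
have Js : symmetric J by move=> i j; rewrite /J adj_sym.
split; first by case: (L) L0.
split=> //; split; first by move=> i; rewrite /J adj_irr.
split.
  have cs : connect_sym J.
    by apply: sym_connect_sym.
  suff cr x : connect J r x.
    by move=> x y; apply: connect_trans (cr y); rewrite cs.
  have [n] := ubnP (size (nth [::] L x)); elim: n x => // n IH x xn.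
  case: (posnP (size (nth [::] L x))) => [/size0nil x0|xp].
    suff -> : x = r by [].
    by apply: val_inj => /=; rewrite -x0 index_uniq.
  set s := nth [::] L x in xn xp.
  have sL : s \in L by apply: mem_nth.
  pose t := take (size s).-1 s.
  have tL : t \in L.
    move: sL; rewrite !LE !mem_filter !mem_words => /andP[h1 /andP[h2 h3]].
    rewrite take_inS // size_take_min.
    have /andP[-> _] := take_inS (size s).-1 h1; apply/andP; split=> //; lia.
  have ti : index t L < size L by rewrite index_mem.
  have tn : nth [::] L (index t L) = t by rewrite nth_index.
  have ts : size t = (size s).-1 by rewrite /t size_take_min; lia.
  apply: connect_trans (IH (Ordinal ti) _) (connect1 _) => /=.
    by rewrite tn ts; lia.
  rewrite /J /= tn -/s /adj /child ts -/t eqxx andbT; apply/orP; left; lia.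
move=> [c [c3 [cu cc]]].
pose f (i : 'I_(size L)) := size (nth [::] L i).
have [x xc xm] : exists2 x, x \in c & forall y, y \in c -> f y <= f x.
  case: c c3 {cu cc} => // x0 c _.
  have x0c : x0 \in x0 :: c by rewrite inE eqxx.
  by case: (arg_maxnP f x0c) => x xc xm; exists x.
have [i c' Ec] := rot_to xc.
have cc' : cycle J (x :: c') by rewrite -Ec rot_cycle.
have cu' : uniq (x :: c') by rewrite -Ec rot_uniq.
have c3' : 3 <= size (x :: c') by rewrite -Ec size_rot.
have xm' y : y \in c' -> f y <= f x.
  by move=> yc; apply: xm; rewrite -(mem_rot i) Ec inE yc orbT.
have par y : y \in c' -> J x y -> child (nth [::] L y) (nth [::] L x).
  by move=> /xm' yx /orP[/andP[/eqP h1 _]|//]; move: yx; rewrite /f h1; lia.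
case: c' {Ec xm} c3' cc' cu' xm' par => // y c'; case/lastP: c' => // c' z _ /=.
rewrite rcons_path last_rcons => /andP[Jxy /andP[_ Jzx]] /andP[_ /andP[yz _]] _ par.
have yz' : y != z by apply: contra yz => /eqP->; rewrite mem_rcons inE eqxx.
have h1 := par y (mem_head _ _) Jxy.
have h2 : child (nth [::] L z) (nth [::] L x).
  by apply: par; rewrite ?inE ?mem_rcons ?inE ?eqxx ?orbT // Js.
have := child_uniq h1 h2; move/eqP; rewrite nth_uniq // => /eqP/val_inj E.
by rewrite E eqxx in yz'.
Qed.

(** * Rainbow copies *)

Section Rainbow.
Variables (T : finType) (e : rel T) (I : seq int).
Local Open Scope ring_scope.

(** The vertex order is not part of the tree: it is the one that [beta] induces on [L]. As blocks
    are disjoint, injectivity of [beta] also makes [phi] injective on [L]. *)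
Definition rainbow (B : int -> {set T}) (L : seq (seq nat)) (phi : seq nat -> T) (beta : seq nat -> int) :=
  [/\ {in L, forall s, beta s \in I /\ phi s \in B (beta s)},
      {in L &, injective beta} &
      {in L &, forall s t, e (phi s) (phi t) = adj s t}].

(** Sorting [L] by [beta] turns the copy into one of an ordered tree [J]. Uniformity then puts a
    copy of [J] on the support given by [beta'], and invariance moves it into [B']. *)
Lemma rainbow_transfer (R : realFieldType) (kappa : R) (tau : nat) (B B' : int -> {set T})
    (d h a : nat) (phi : seq nat -> T) (beta beta' : seq nat -> int) (L := Slist d h a) :
  irreflexive e -> support_uniform e tau I B -> support_invariant e kappa tau I B ->
  (size L <= tau)%N -> contraction I B' B -> kappa * (width I B)%:R <= (width I B')%:R ->
  rainbow B L phi beta -> {in L, forall s, beta' s \in I} ->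
  {in L &, forall s t, (beta s < beta t) = (beta' s < beta' t)} ->
  exists phi', rainbow B' L phi' beta'.
Proof.
move=> eI unif inv sL con wid [hb binj he] hb' mono.
have b'inj : {in L &, injective beta'}.
  move=> s t sLs tL E; apply: binj => //.
  by case: (ltgtP (beta s) (beta t)) => //; rewrite mono // E ltxx.
pose L' := sort (fun s t => beta s <= beta t) L.
have pL : perm_eq L' L by rewrite /L' perm_sort.
have uL' : uniq L' by rewrite (perm_uniq pL) uniq_Slist.
have mL' : L' =i L by exact: perm_mem.
have szL' : size L' = size L by rewrite size_sort.
pose k := size L'.
have nL (i : 'I_k) : nth [::] L' i \in L by rewrite -mL' mem_nth.
pose J (i j : 'I_k) := adj (nth [::] L' i) (nth [::] L' j).
have Jt : ordered_tree J by exact: ordered_tree_Slist mL' uL'.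
have srt : sorted (fun s t => beta s <= beta t) L'.
  by apply: sort_sorted => s t; exact: le_total.
have incr (i j : 'I_k) : (i < j)%N -> beta (nth [::] L' i) < beta (nth [::] L' j).
  move=> ij; rewrite lt_neqAle; apply/andP; split.
    apply/eqP=> /binj => /(_ (nL i) (nL j)) /eqP.
    by rewrite nth_uniq // => /eqP E; rewrite E ltnn in ij.
  have tr : transitive (fun s t => beta s <= beta t) by move=> x y z; exact: le_trans.
  by apply: (sorted_ltn_nth tr [::] srt) => //; rewrite ?inE ?ltn_ord.
have tr0 : in_trace e I B J (map beta L').
  exists (fun i => phi (nth [::] L' i)), (fun i => beta (nth [::] L' i)).
  split; last first.
    move=> x; split.
      case/(nthP 0) => i; rewrite size_map => il <-.
      by exists (Ordinal il); rewrite (nth_map [::]).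
    by case=> i <-; rewrite map_f // mL'.
  split; first by move=> i; case: (hb _ (nL i)).
  split; first by move=> i; case: (hb _ (nL i)).
  by split=> // i j _; rewrite he.
pose S1 := map beta' L'.
have uS1 : uniq S1.
  rewrite map_inj_in_uniq // => s t; rewrite !mL'; exact: b'inj.
have tr1 : in_trace e I B J S1.
  have kt : (k <= tau)%N by rewrite /k szL'.
  case: (unif _ _ Jt kt) => [/(_ _ tr0)//|]; apply => //.
    by move=> x /mapP[s sL' ->]; apply: hb'; rewrite -mL'.
  by rewrite size_map.
have kt : (k <= tau)%N by rewrite /k szL'.
have [f [g [[g1 [g2 [g3 g4]]] g5]]] := (inv _ con wid _ _ Jt kt S1).1 tr1.
(* The trace only fixes the support as a set; two increasing enumerations of the same set agree, so
   each vertex lands in its prescribed block. *)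
have Eg i : g i = beta' (nth [::] L' i).
  have E : [seq g i | i <- enum 'I_k] = S1.
    apply: (irr_sorted_eq lt_trans ltxx).
    - apply: (homo_sorted (e := fun i j : 'I_k => (i < j)%N)) => //.
      by have := iota_ltn_sorted 0 k; rewrite -val_enum_ord sorted_map.
    - rewrite (sorted_pairwise lt_trans); apply/(pairwiseP 0) => i1 j1; rewrite !inE !size_map => il jl ij.
      rewrite !(nth_map [::]) // -mono; first exact: (incr (Ordinal il) (Ordinal jl)).
        exact: (nL (Ordinal il)).
      exact: (nL (Ordinal jl)).
    - move=> x; apply/mapP/idP.
        by case=> i1 _ ->; apply/g5; exists i1.
      by move/g5 => [i1 <-]; exists i1; rewrite ?mem_enum.
  have := congr1 (fun s => nth 0 s i) E.
  by rewrite (nth_map i) ?size_enum_ord // nth_ord_enum (nth_map [::]).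
(* Outside [L] the map [phi'] takes the dummy value [phi s]. *)
have ix s : s \in L -> (index s L' < k)%N by rewrite -mL' index_mem.
pose phi' s := if insub (index s L') is Some i then f (i : 'I_k) else phi s.
have phi'E s (sLs : s \in L) : phi' s = f (Ordinal (ix s sLs)).
  by rewrite /phi' (insubT (fun i => (i < k)%N) (ix s sLs)).
have nx s (sLs : s \in L) : nth [::] L' (Ordinal (ix s sLs)) = s.
  by rewrite nth_index // mL'.
exists phi'; split.
- by move=> s sLs; split; [exact: hb' | have := g2 (Ordinal (ix s sLs)); rewrite Eg nx phi'E].
- exact: b'inj.
- move=> s t sLs tLt.
  case: (eqVneq s t) => [->|st]; first by rewrite eI adj_irr.
  rewrite !phi'E g4 /J ?nx //.
  by apply: contra st => /eqP E; rewrite -(nx s sLs) E (nx t tLt).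
Qed.

End Rainbow.

Lemma inS_mono d a b s : a <= b -> inS d a s -> inS d b s.
Proof. by move=> ab; rewrite /inS; case: s => [|x s] //= /andP[-> H] /=; lia. Qed.

(** From [S_a] to [S_(a+1)] only branch [a %% d] changes: it becomes [T(d, a %/ d)], which is
    [S_(d * (a %/ d))]. *)
Lemma inS_succ_head d a s : 1 < d ->
  inS d a.+1 ((a %% d) :: s) -> inS d (d * (a %/ d)) s.
Proof.
move=> d1; rewrite /inS /= => /andP[/andP[h1 h2] h3]; rewrite h2 /=.
case: s h2 h3 => [|x s] //= /andP[hx _] h3.
have := divn_eq a d; nia.
Qed.

Lemma inS_succ_other d a x s : 1 < d -> x != a %% d -> inS d a.+1 (x :: s) -> inS d a (x :: s).
Proof.
move=> d1 xa; rewrite /inS /= => /andP[/andP[h1 h2] h3]; rewrite h1 h2 /=.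
rewrite ltnS leq_eqVlt in h3; case/orP: h3 => [/eqP h3|//].
move: xa; rewrite -h3 modnMDl modn_small ?eqxx //.
Qed.

Section Rainbow.
Variables (T : finType) (e : rel T) (I : seq int).
Local Open Scope ring_scope.

(** The first copy keeps all branches except number [a %% d], which is replaced by a part of the
    second copy; this fits because [d * (a %/ d) <= a <= b]. The single cross edge attaches the new
    branch to the root. The last clause locates the non-root vertices, so that the root can later be
    shown to stay outermost. *)
Lemma rainbow_join (B : int -> {set T}) d h a b phi1 beta1 phi2 beta2 :
  symmetric e -> (1 < d)%N -> (a <= b)%N -> (a < d * h)%N -> (b <= d * h)%N ->
  rainbow e I B (Slist d h a) phi1 beta1 -> rainbow e I B (Slist d h b) phi2 beta2 ->
  {in Slist d h a & Slist d h b, forall s t, beta1 s <> beta2 t} ->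
  {in Slist d h a & Slist d h b, forall s t,
     e (phi1 s) (phi2 t) = (s == [::]) && (t == [::])} ->
  exists phi beta, [/\ rainbow e I B (Slist d h a.+1) phi beta, beta [::] = beta1 [::] &
    {in Slist d h a.+1, forall s, s != [::] ->
       (exists2 t, t \in Slist d h a & (t != [::]) && (beta s == beta1 t)) \/
       (exists2 t, t \in Slist d h b & beta s == beta2 t)}].
Proof.
move=> eS d1 ab ah bh [A1 A2 A3] [B1 B2 B3] dis cross.
pose m := (a %% d)%N.
pose new s := if s is x :: t then x == m else false.
pose glue (U : Type) (f g : seq nat -> U) s := if new s then g (behead s) else f s.
have glueP s : s \in Slist d h a.+1 ->
    (new s /\ s = m :: behead s /\ behead s \in Slist d h b) \/
    (new s = false /\ s \in Slist d h a).
  rewrite !mem_Slist //; try lia.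
  case: s => [|x s] H; first by right.
  case: (boolP (x == m)) => xm /=; rewrite ?(eqP xm) ?eqxx.
    left; do 2!split => //; rewrite (eqP xm) in H.
    apply: inS_mono (inS_succ_head d1 H); apply: leq_trans ab.
    by rewrite mulnC leq_divM.
  by right; split; [exact: negbTE | exact: inS_succ_other H].
exists (glue _ phi1 phi2), (glue _ beta1 beta2); split=> //.
- split.
  + move=> s /glueP[[ns [_ sb]]|[ns sa]]; rewrite /glue ns; [exact: B1|exact: A1].
  + move=> s t /glueP[[ns [Es sb]]|[ns sa]] /glueP[[nt [Et tb]]|[nt ta]]; rewrite /glue ns nt.
    * by move/B2 => /(_ sb tb) E; rewrite Es Et E.
    * by move/esym/dis => /(_ ta sb).
    * by move/dis => /(_ sa tb).
    * exact: A2.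
  + have Pn s t : new s -> s = m :: behead s -> new t = false ->
        adj s t = (t == [::]) && (behead s == [::]).
      move=> ns -> ; case: t => [|y t] nt; first by rewrite adj_sym adj_nil.
      by rewrite adj_cons eq_sym [y == m]nt.
    move=> s t /glueP[[ns [Es sb]]|[ns sa]] /glueP[[nt [Et tb]]|[nt ta]]; rewrite /glue ns nt.
    * by rewrite B3 // [in RHS]Es [in RHS]Et adj_cons eqxx.
    * by rewrite eS cross // (Pn _ _ ns Es nt).
    * by rewrite cross // adj_sym (Pn _ _ nt Et ns).
    * exact: A3.
- move=> s /glueP[[ns [_ sb]]|[ns sa]] s0; rewrite /glue ns.
    by right; exists (behead s).
  by left; exists s => //; rewrite s0 eqxx.
Qed.

Lemma width_in (B : int -> {set T}) i : equicardinal I B -> i \in I -> width I B = #|B i|.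
Proof.
case: I => // j I' eq ij; rewrite (eq i j) ?mem_head //=.
have : {in I', forall k, #|B k| = #|B j|}.
  by move=> k kI; apply: eq; rewrite ?mem_head // inE kI orbT.
elim: I' {eq ij} => //= k I' IH H; rewrite IH; last first.
  by move=> x xI; apply: H; rewrite inE xI orbT.
by rewrite H ?mem_head // minnn.
Qed.

Lemma width_ge (B : int -> {set T}) m : I != [::] -> {in I, forall i, (m <= #|B i|)%N} ->
  (m <= width I B)%N.
Proof.
case: I => // j I' _ H /=.
have := H j (mem_head _ _).
have : {in I', forall i, (m <= #|B i|)%N} by move=> i iI; apply: H; rewrite inE iI orbT.
elim: I' {H} => //= k I' IH H Hj; rewrite leq_min H ?mem_head //=.
by apply: IH => // i iI; apply: H; rewrite inE iI orbT.
Qed.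

(* Removing fewer than half of the vertices of each block keeps the blockade wide
   enough for support-invariance, so copies can be chosen greedily. *)
Lemma disjoint_copies (R : realFieldType) (kappa : R) (tau : nat) (B : int -> {set T})
    (d h a : nat) (phi : seq nat -> T) (beta beta' : seq nat -> int) (L := Slist d h a) :
  irreflexive e -> equicardinal I B -> kappa <= 2^-1 -> (0 < width I B)%N ->
  support_uniform e tau I B -> support_invariant e kappa tau I B ->
  (size L <= tau)%N ->
  rainbow e I B L phi beta -> {in L, forall s, beta' s \in I} ->
  {in L &, forall s t, (beta s < beta t) = (beta' s < beta' t)} ->
  exists Phi : nat -> seq nat -> T,
    (forall t, (t < uphalf (width I B))%N -> rainbow e I B L (Phi t) beta') /\
    (forall t t' s, (t < uphalf (width I B))%N -> (t' < uphalf (width I B))%N ->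
        s \in L -> Phi t s = Phi t' s -> t = t').
Proof.
move=> eI eq k2 w0 unif inv sL rb hb' mono.
have b'inj : {in L &, injective beta'}.
  case: rb => _ binj _ s t sLs tL E; apply: binj => //.
  by case: (ltgtP (beta s) (beta t)) => //; rewrite mono // E ltxx.
have [b0 b0I] : exists i, i \in I by exists (beta' [::]); apply: hb'; exact: nil_Slist.
have : (uphalf (width I B) <= uphalf (width I B))%N by [].
(* The occurrence left alone is the cap; the others become the number of copies found so far. *)
elim: {1 3 4 5}(uphalf (width I B)) => [|n IH] nw; first by exists (fun=> phi).
have [Phi [P1 P2]] := IH (ltnW nw).
(* [site i] is the word placed in block [i], so each copy already chosen costs the block at most one
   vertex. *)
pose site i := nth [::] L (index i (map beta' L)).
pose B' i := B i :\: [set Phi t (site i) | t : 'I_n].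
have cB i : i \in I -> (width I B - n <= #|B' i|)%N.
  move=> iI; rewrite (width_in eq iI) cardsD leq_sub2l //.
  apply: leq_trans (subset_leq_card (subsetIr _ _)) _.
  by apply: leq_trans (leq_imset_card _ _) _; rewrite card_ord.
have con : contraction I B' B.
  move=> i iI; split; first exact: subsetDl.
  by rewrite -card_gt0; apply: leq_trans (cB i iI); lia.
have wid : kappa * (width I B)%:R <= (width I B')%:R.
  have I0 : I != [::] by case: (I) b0I.
  have h1 := width_ge I0 cB.
  have h2 : (width I B <= 2 * width I B')%N by lia.
  apply: le_trans (_ : 2^-1 * (width I B)%:R <= _).
    by rewrite ler_wpM2r.
  by rewrite ler_pdivrMl ?ltr0n // -natrM ler_nat.
have [phi' [Q1 Q2 Q3]] := rainbow_transfer eI unif inv sL con wid rb hb' mono.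
have siteE s : s \in L -> site (beta' s) = s.
  by move=> sLs; rewrite /site nth_index_map.
have new t s : (t < n)%N -> s \in L -> Phi t s <> phi' s.
  move=> tn sLs E; have [_] := Q1 s sLs; rewrite inE => /andP[/negP H _]; apply: H.
  by rewrite siteE // -E; apply/imsetP; exists (Ordinal tn).
exists (fun t => if t == n then phi' else Phi t); split.
  move=> t; rewrite ltnS leq_eqVlt; case: eqP => [_ _|_ /= tn]; last exact: P1.
  split=> // s sLs; have [h1] := Q1 s sLs; rewrite inE => /andP[_ h2]; by [].
move=> t t' s; rewrite !ltnS (leq_eqVlt t) (leq_eqVlt t').
case: (eqVneq t n) => [->|tn] /=; case: (eqVneq t' n) => [->|tn'] //=.
- by move=> _ h1 sLs /esym /(new _ _ h1 sLs).
- by move=> h1 _ sLs /(new _ _ h1 sLs).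
- exact: P2.
Qed.

End Rainbow.

(** * Four families of disjoint copies *)

Lemma card_has_le (A : Type) (X : finType) (Q : A -> pred X) (s : seq A) :
  #|[set y | has (fun a => Q a y) s]| <= \sum_(a <- s) #|[set y | Q a y]|.
Proof.
elim: s => [|a s IH] /=.
  by rewrite big_nil leqn0 cards_eq0; apply/eqP/setP=> y; rewrite !inE.
rewrite big_cons; apply: leq_trans (leq_add (leqnn _) IH).
apply: leq_trans (leq_card_setU _ _); apply/subset_leq_card/subsetP=> y.
by rewrite !inE.
Qed.

Lemma card_setX_fibers (A C : finType) (Y : {set A * C}) :
  #|Y| = \sum_a #|[set c | (a, c) \in Y]|.
Proof.
rewrite -sum1_card big_mkcond /=.
rewrite (eq_bigr (fun p : A * C => if (p.1, p.2) \in Y then 1 else 0)); last by case.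
rewrite -(pair_bigA _ (fun a c => if (a, c) \in Y then 1 else 0)) /=.
apply: eq_bigr => a _; rewrite -sum1_card [RHS]big_mkcond /=.
by apply: eq_bigr => c _; rewrite inE.
Qed.

Section Core.
Variables (R : realFieldType) (T : finType) (e : rel T) (I : seq int) (B : int -> {set T}).
Variables (lam eps : R) (K tau : nat).
Local Open Scope ring_scope.
Let w := width I B.
Let N := uphalf w.
Hypotheses (eS : symmetric e) (coh : coherent e eps) (blk : blockade I B)
  (eqc : equicardinal I B) (conc : concave e lam I B).
Hypotheses (w0 : (0 < w)%N) (K1000 : (1000 <= K)%N) (tau0 : (0 < tau)%N)
  (epsw : K%:R * (eps * #|T|%:R) <= w%:R) (lamK : lam * (K * tau)%:R <= 1) (lam0 : 0 < lam).

(** [K] stands for $2^{9\delta}$. This lemma and the next three replace the real thresholds by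
    integer comparisons, using that $\lambda w\le w/(K\tau)$ and $\epsilon|G|\le w/K$. *)
Lemma lam_le c : (w <= K * c)%N -> lam * w%:R <= c%:R.
Proof.
move=> H; have K0 : (0 : R) < K%:R by rewrite ltr0n; lia.
rewrite -(ler_pM2l K0) -natrM; apply: le_trans (_ : w%:R <= _); last by rewrite ler_nat.
rewrite mulrA -[leRHS]mul1r ler_wpM2r // mulrC.
apply: le_trans lamK; rewrite (ler_wpM2l (ltW lam0)) // ler_nat; nia.
Qed.

Lemma le_lam c j : c%:R <= (j * tau)%:R * (lam * w%:R) -> (K * c <= j * w)%N.
Proof.
move=> H; rewrite -(ler_nat R) natrM.
apply: le_trans (ler_wpM2l (ler0n _ _) H) _.
have -> : K%:R * ((j * tau)%:R * (lam * w%:R)) = (j * w)%:R * (lam * (K * tau)%:R).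
  rewrite !natrM; set a := K%:R; set b := j%:R; set c1 := tau%:R; set f := w%:R.
  by rewrite mulrC -!mulrA; congr (_ * _); rewrite [LHS]mulrC -!mulrA [RHS]mulrC -!mulrA;
    congr (_ * _); rewrite mulrC -mulrA; congr (_ * _); rewrite mulrC.
by rewrite -[leRHS]mulr1 ler_wpM2l.
Qed.

Lemma eps_le c : c%:R < eps * #|T|%:R -> (K * c <= w)%N.
Proof.
move=> H; rewrite -(ler_nat R) natrM; apply: le_trans epsw.
by rewrite ler_wpM2l // ltW.
Qed.

Lemma le_eps c : (w <= K * c)%N -> eps * #|T|%:R <= c%:R.
Proof.
have K0 : (0 : R) < K%:R by rewrite ltr0n; lia.
move=> H; rewrite -(ler_pM2l K0) -natrM; apply: le_trans epsw _.
by rewrite ler_nat.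
Qed.

Lemma block_eq i j v : i \in I -> j \in I -> v \in B i -> v \in B j -> i = j.
Proof.
move=> iI jI vi vj; apply/eqP/negPn/negP=> ij; case: blk => _ [_ dis].
by have /pred0P/(_ v) := dis i j iI jI ij; rewrite /= vi vj.
Qed.

(** Concavity in the form used below: missing a fraction [1/K] of both outer blocks is enough, since
    $\lambda\le 1/K$. *)
Lemma cover_small h1 h2 h3 (X : {set T}) :
  h1 \in I -> h2 \in I -> h3 \in I -> h1 < h2 -> h2 < h3 ->
  {in X, forall v, exists i, [/\ i \in I, v \in B i, i != h1, i != h2 & i != h3]} ->
  (w <= K * #|[set v in B h1 | [forall x in X, ~~ e v x]]|)%N ->
  (w <= K * #|[set v in B h3 | [forall x in X, ~~ e v x]]|)%N ->
  #|[set v in B h2 | [exists x in X, e v x]]|%:R < lam * w%:R.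
Proof.
move=> i1 i2 i3 h12 h23 HX m1 m3; rewrite ltNge; apply/negP=> cov; apply: conc.
exists h1, h2, h3, X.
have D j : j \in I -> {in X, forall v, exists i, [/\ i \in I, v \in B i & i != j]} ->
    [disjoint X & B j].
  move=> jI H; apply/pred0P=> v /=; apply/negbTE/negP=> /andP[vX vj].
  by have [i [iI vi]] := H v vX; rewrite (block_eq iI jI vi vj) eqxx.
have D1 : [disjoint X & B h1] by apply: D => // v /HX[i []]; exists i.
have D2 : [disjoint X & B h2] by apply: D => // v /HX[i []]; exists i.
have D3 : [disjoint X & B h3] by apply: D => // v /HX[i []]; exists i.
split=> //; split=> //; split=> //; split; last first.
  by split; [|split]; split=> //; exact: lam_le.
apply/subsetP=> v vX; rewrite !inE !negb_or.
rewrite (disjointFr D1 vX) (disjointFr D2 vX) (disjointFr D3 vX) /=.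
have [i [iI vi _ _ _]] := HX v vX.
by rewrite /Vblock (big_rem i iI) inE vi.
Qed.


(** * Contacts between the copies of several families *)

Section Families.
(** [Phi g t] is the [t]-th copy in family [g]. [en g g'] marks the root of [g'] as outermost seen
    from [g]; every other foreign vertex lies strictly between the roots of [lft g] and [rgt g]. The
    blocks [lo] and [hi] enclose all families. *)
Variables (G : finType) (L : G -> seq (seq nat)) (en : rel G) (lft rgt : G -> G).
Variables (beta : G -> seq nat -> int) (Phi : G -> nat -> seq nat -> T) (lo hi : int).
Hypotheses (g0 : G) (G4 : (#|G| <= 4)%N).
Hypotheses (Lnil : forall g, [::] \in L g) (Lsize : forall g, (size (L g) <= tau)%N).
Hypotheses
  (inI : forall g s, s \in L g -> beta g s \in I)
  (inB : forall g t s, (t < N)%N -> s \in L g -> Phi g t s \in B (beta g s))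
  (Phi_inj : forall g t t' s, (t < N)%N -> (t' < N)%N -> s \in L g ->
     Phi g t s = Phi g t' s -> t = t')
  (beta_disj : forall g g' s s', g != g' -> s \in L g -> s' \in L g' -> beta g s != beta g' s').
Hypotheses (lftN : forall g, lft g != g) (rgtN : forall g, rgt g != g)
  (between : forall g g' s', g' != g -> s' \in L g' -> ~~ ((s' == [::]) && en g g') ->
     beta (lft g) [::] < beta g' s' < beta (rgt g) [::])
  (loI : lo \in I) (hiI : hi \in I)
  (lohi : forall g s, s \in L g -> lo < beta g s < hi).

Lemma N_ge : (w <= 2 * N)%N.
Proof. by rewrite /N; lia. Qed.

Lemma item_inj g s : s \in L g -> injective (fun t : 'I_N => Phi g t s).
Proof. by move=> sL t t' /(Phi_inj (ltn_ord _) (ltn_ord _) sL) /val_inj. Qed.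

Let X := (G * 'I_N)%type.
Let V (x : X) s := Phi x.1 x.2 s.
Let touch (x y : X) := (x.1 != y.1) &&
  has (fun s => has (fun s' => e (V x s) (V y s')) (L y.1)) (L x.1).
Let bad (x y : X) := (x.1 != y.1) &&
  has (fun s => has (fun s' => ~~ ((s' == [::]) && en x.1 y.1) && e (V x s) (V y s')) (L y.1))
      (L x.1).
Let Nb (Y : {set X}) := [set y | [exists x in Y, touch x y]].
(** At most four families each contribute at most [w / K] bad contacts; [M] is then the value that
    the counting lemma asks for. *)
Let m := (4 * w %/ K)%N.
Let M := (3 * (#|G| * m))%N.

(** The degree bound alone gives [w / K] neighbours, too many once summed over the up to [tau]
    vertices of a copy. It does show that [v] misses most of the spare blocks [lo] and [hi], and
    concavity then improves the bound to $\lambda w$. *)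
Lemma single_cover g s v g' : s \in L g -> v \in B (beta g s) -> g != g' ->
  #|[set u in B (beta g' [::]) | e u v]|%:R <= lam * w%:R.
Proof.
move=> sL vB gg'.
have [lo1 hi1] := andP (lohi sL); have [lo2 hi2] := andP (lohi (Lnil g')).
have miss i : i \in I -> (w <= K * #|[set u in B i | [forall x in [set v], ~~ e u x]]|)%N.
  move=> iI.
  have -> : [set u in B i | [forall x in [set v], ~~ e u x]] = B i :\: [set u | e v u].
    apply/setP=> u; rewrite !inE andbC; congr (_ && _); rewrite eS; apply/forall_inP/idP.
      by apply; rewrite inE.
    by move=> H x; rewrite inE => /eqP->.
  have := eps_le (coh.2.1 v).
  have := cardsID [set u | e v u] (B i); rewrite -(width_in eqc iI) -/w.
  have := subset_leq_card (subsetIr (B i) [set u | e v u]).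
  by move=> h1 h2 h3; nia.
have -> : [set u in B (beta g' [::]) | e u v] =
    [set u in B (beta g' [::]) | [exists x in [set v], e u x]].
  apply/setP=> u; rewrite !inE; congr (_ && _); apply/idP/exists_inP.
    by exists v; rewrite ?inE.
  by case=> x; rewrite inE => /eqP->.
apply/ltW/(cover_small loI _ hiI lo2 hi2) => //; rewrite ?inI ?miss //.
move=> x; rewrite inE => /eqP->; exists (beta g s); split; rewrite ?inI //.
- by rewrite gt_eqF.
- exact: beta_disj.
- by rewrite lt_eqF.
Qed.

(** The vertices [Z] of the chosen copies in family [g] miss much of the root blocks of [lft g] and
    [rgt g]. By concavity they cover less than $\lambda w$ of each block in between; summing over at
    most [tau] words gives at most [w / K] bad contacts per family. *)
Lemma bad_cover (Y : {set X}) x g : (#|Nb Y| <= M)%N ->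
  (#|[set y | [exists z in x |: Y, (z.1 == g) && bad z y]]| <= m)%N.
Proof.
move=> NY; rewrite /m leq_divRL; last by lia.
rewrite mulnC.
pose Z := [set v | [exists z in x |: Y, (z.1 == g) && has (fun s => V z s == v) (L g)]].
have ZB v : v \in Z -> exists2 s, s \in L g & v \in B (beta g s).
  rewrite inE => /exists_inP[[g1 t] _ /andP[/eqP /= ->] /hasP[s sL /eqP <-]].
  by exists s => //; apply: inB.
have K4 : (K * M <= 48 * w)%N.
  have := leq_divM (4 * w) K; rewrite -/m /M => H.
  have : (#|G| * m <= 4 * m)%N by rewrite leq_mul2r G4 orbT.
  by nia.
(* Of the [N] copies in family [l], at most [M] touch [Y] ([C1]) and at most [w / K] have a root
   adjacent to [x] ([C2]). After scaling by [K] at least [1000 * N - 49 * w] is left, well above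
   [w]. *)
have miss l : l != g ->
    (w <= K * #|[set v in B (beta l [::]) | [forall u in Z, ~~ e v u]]|)%N.
  move=> lg.
  pose C1 := [set t : 'I_N | (l, t) \in Nb Y].
  pose C2 := [set t : 'I_N | (x.1 == g) && has (fun s => e (Phi l t [::]) (V x s)) (L g)].
  have c1 : (#|C1| <= M)%N.
    apply: leq_trans NY; rewrite -(card_imset (mem C1) (f := fun t => (l, t))); last first.
      by move=> t t' [].
    by apply/subset_leq_card/subsetP=> y /imsetP[t]; rewrite inE => h ->.
  have c2 : (K * #|C2| <= w)%N.
    rewrite -[leqRHS]mul1n; apply: le_lam; rewrite mul1n.
    rewrite /C2; case: (eqVneq x.1 g) => [xg|_] /=; last first.
      by rewrite (_ : [set t | false] = set0) ?cards0; [rewrite mulr_ge0 ?mulr_ge0 // ltW|apply/setP=> t; rewrite !inE].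
    apply: le_trans (_ : (\sum_(s <- L g) #|[set t : 'I_N | e (Phi l t [::]) (V x s)]|)%:R <= _).
      by rewrite ler_nat card_has_le.
    rewrite natr_sum.
    apply: le_trans (_ : \sum_(s <- L g) lam * w%:R <= _).
      rewrite !big_seq; apply: ler_sum => s sL.
      have vB : V x s \in B (beta g s) by rewrite -xg; apply: inB; rewrite ?xg.
      apply: le_trans (single_cover sL vB (_ : g != l)); last by rewrite eq_sym.
      rewrite ler_nat -(card_in_imset (f := fun t : 'I_N => Phi l t [::])).
        apply/subset_leq_card/subsetP=> v /imsetP[t]; rewrite !inE => h ->.
        by rewrite h andbT; apply: inB.
      by apply: in2W; exact: item_inj.
    rewrite big_const_seq count_predT iter_addr_0 -[_ *+ _]mulr_natl ler_wpM2r //.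
      by rewrite mulr_ge0 // ltW.
    by rewrite ler_nat.
  have c3 : (N - (M + #|C2|) <= #|[set v in B (beta l [::]) | [forall u in Z, ~~ e v u]]|)%N.
    apply: leq_trans (_ : #|~: (C1 :|: C2)| <= _)%N.
      have := cardsC (C1 :|: C2); rewrite card_ord.
      by have := leq_of_leqif (leq_card_setU C1 C2); lia.
    rewrite -(card_in_imset (f := fun t : 'I_N => Phi l t [::])); last first.
      by apply: in2W; exact: item_inj.
    apply/subset_leq_card/subsetP=> v /imsetP[t tC ->]; rewrite inE inB //=.
    apply/forall_inP=> u; rewrite inE => /exists_inP[z zY /andP[/eqP zg /hasP[s sL /eqP <-]]].
    apply/negP=> ez; move: tC; rewrite !inE negb_or => /andP[/negP n1 /negP n2].
    move: zY; rewrite !inE => /orP[/eqP zx|zY].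
      by apply: n2; rewrite -zx zg eqxx; apply/hasP; exists s.
    apply: n1; apply/exists_inP; exists z => //; rewrite /touch /= zg eq_sym lg /=.
    apply/hasP; exists s => //; apply/hasP; exists [::] => //=.
    by rewrite eS.
  have Nw := N_ge; move: (#|C2|) c2 c3 => k2 c2.
  set c := #|[set v in _ | _]| => c3.
  have : (K * (N - (M + k2)) <= K * c)%N by rewrite leq_mul2l c3 orbT.
  rewrite mulnBr mulnDr => H.
  have : (1000 * N <= K * N)%N by rewrite leq_mul2r K1000 orbT.
  by lia.
rewrite card_setX_fibers.
apply: leq_trans (_ : \sum_(g' : G) w <= _)%N; last first.
  by rewrite sum_nat_const leq_mul2r G4 orbT.
rewrite big_distrr /=; apply: leq_sum => g' _.
rewrite -[leqRHS]mul1n; apply: le_lam; rewrite mul1n.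
case: (eqVneq g' g) => [->|gg].
  rewrite (_ : [set c | _] = set0) ?cards0; last first.
    apply/setP=> t; rewrite !inE; apply/negbTE/negP=> /exists_inP[z _ /andP[/eqP zg]].
    by rewrite /bad /= zg eqxx.
  by rewrite !mulr_ge0 // ltW.
apply: le_trans (_ : (\sum_(s' <- L g') #|[set t : 'I_N | [&& s' \in L g', ~~ ((s' == [::]) && en g g') &
   [exists v in Z, e (Phi g' t s') v]]]|)%:R <= _).
  rewrite ler_nat; apply: leq_trans (card_has_le _ _).
  apply/subset_leq_card/subsetP=> t; rewrite !inE => /exists_inP[z zY /andP[/eqP zg]].
  rewrite /bad /= => /andP[_ /hasP[s sL /hasP[s' sL' /andP[h1 h2]]]].
  apply/hasP; exists s' => //; rewrite sL' -zg h1 /=; apply/exists_inP; exists (V z s).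
    by rewrite inE; apply/exists_inP; exists z => //; rewrite zg eqxx; apply/hasP; exists s; rewrite -?zg.
  by rewrite eS.
rewrite natr_sum.
apply: le_trans (_ : \sum_(s <- L g') lam * w%:R <= _); last first.
  rewrite big_const_seq count_predT iter_addr_0 -[_ *+ _]mulr_natl ler_wpM2r //.
    by rewrite mulr_ge0 // ltW.
  by rewrite ler_nat.
rewrite !big_seq; apply: ler_sum => s' sL'; rewrite sL' /=.
case: (boolP ((s' == [::]) && en g g')) => /= nb.
  by rewrite (_ : [set c | _] = set0) ?cards0; [rewrite mulr_ge0 // ltW|apply/setP=> t; rewrite !inE].
have [b1 b2] := andP (between gg sL' nb).
apply/ltW/(le_lt_trans _ (cover_small _ _ _ b1 b2 _ (miss _ (lftN g)) (miss _ (rgtN g)))); rewrite ?inI //.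
  rewrite ler_nat -(card_in_imset (f := fun t : 'I_N => Phi g' t s')).
    apply/subset_leq_card/subsetP=> v /imsetP[t]; rewrite !inE => h ->.
    by rewrite h andbT; apply: inB.
  by apply: in2W; exact: item_inj.
move=> v /ZB[s sL vB]; exists (beta g s); split; rewrite ?inI ?beta_disj //.
- by rewrite eq_sym.
- by rewrite eq_sym.
- by rewrite eq_sym.
Qed.

(** In each family, [Y] has fewer than $\epsilon|G|$ copies: otherwise their roots, against the
    roots of the copies in the foreign family [lft g] that [Y] does not touch, contradict coherence.
    Scaled by [K], the two terms are at most [#|G| * w] and [12 * (#|G| * w)]. *)
Lemma few_removed (Y : {set X}) : (#|Nb Y| <= M)%N -> (#|Y| + #|Nb Y| < #|{: X}|)%N.
Proof.
move=> NY.
have KM : (K * M <= 12 * (#|G| * w))%N.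
  have := leq_divM (4 * w) K; rewrite -/m /M => H.
  have : (#|G| * (m * K) <= #|G| * (4 * w))%N by rewrite leq_mul2l H orbT.
  by nia.
have G0 : (0 < #|G|)%N by apply/card_gt0P; exists g0.
have Nw := N_ge.
have KN : (1000 * N <= K * N)%N by rewrite leq_mul2r K1000 orbT.
have KM4 : (K * M <= 48 * w)%N.
  have : (#|G| * w <= 4 * w)%N by rewrite leq_mul2r G4 orbT.
  by lia.
have KY : (K * #|Y| <= #|G| * w)%N.
  rewrite card_setX_fibers big_distrr /= -sum_nat_const; apply: leq_sum => g _.
  set Yg := [set c | _]; apply: eps_le; rewrite ltNge; apply/negP=> big.
  pose rt l (t : 'I_N) := Phi l t [::].
  have ri l : injective (rt l).
    exact: item_inj.
  pose D := [set t : 'I_N | (lft g, t) \notin Nb Y].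
  have cD : (w <= K * #|D|)%N.
    have c1 : (#|~: D| <= M)%N.
      apply: leq_trans NY; rewrite -(card_imset (mem (~: D)) (f := fun t => (lft g, t))); last first.
        by move=> t t' [].
      by apply/subset_leq_card/subsetP=> y /imsetP[t]; rewrite inE !inE negbK => h ->.
    have := cardsC D; rewrite card_ord => c2.
    have : (K * (N - M) <= K * #|D|)%N by rewrite leq_mul2l; lia.
    by rewrite mulnBr; lia.
  apply: coh.2.2; exists (rt g @: Yg), (rt (lft g) @: D); split; last first.
    split; first by rewrite card_imset.
    split; first by rewrite card_imset //; exact: le_eps.
    move=> _ _ /imsetP[t tY ->] /imsetP[t' tD ->]; apply/negP=> ed.
    move: tD; rewrite inE inE => /negP; apply; apply/exists_inP; exists (g, t).
      by move: tY; rewrite inE.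
    rewrite /touch /= eq_sym lftN /=; apply/hasP; exists [::] => //.
    by apply/hasP; exists [::].
  apply/pred0P=> v /=; apply/negbTE/negP=> /andP[/imsetP[t _ ->] /imsetP[t' _ E]].
  have := beta_disj (lftN g) (Lnil _) (Lnil _); rewrite eq_sym => /eqP; apply.
  by apply: (block_eq _ _ (inB (ltn_ord t) (Lnil g))); rewrite ?inI // [Phi _ _ _]E; apply: inB.
rewrite card_prod card_ord.
have K0 : (0 < K)%N by lia.
rewrite -(ltn_pmul2l K0) mulnDr.
have : (K * #|Nb Y| <= K * M)%N by rewrite leq_mul2l NY orbT.
have : (#|G| * (1000 * N) <= #|G| * (K * N))%N by rewrite leq_mul2l KN orbT.
have : (#|G| * w <= #|G| * (2 * N))%N by rewrite leq_mul2l Nw orbT.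
have : (0 < #|G| * w)%N by rewrite muln_gt0 G0.
by rewrite (mulnCA K); lia.
Qed.

(** The counting lemma leaves a contact that is bad in neither direction. Every edge of such a
    contact ends in an outermost root on both sides, hence joins the two roots. *)
Lemma root_root_pair : exists g g' t t', [/\ g != g', (t < N)%N /\ (t' < N)%N,
   en g g' /\ en g' g, e (Phi g t [::]) (Phi g' t' [::]) &
   {in L g & L g', forall s s', e (Phi g t s) (Phi g' t' s') = (s == [::]) && (s' == [::])}].
Proof.
case: (boolP [exists x, exists y, [&& touch x y, ~~ bad x y & ~~ bad y x]]); last first.
  move/existsPn=> H; exfalso.
  have tS : symmetric touch.
    suff tS x y : touch x y -> touch y x by move=> x y; apply/idP/idP; exact: tS.
    case/andP=> xy /hasP[s sL /hasP[s' sL' h]]; rewrite /touch eq_sym xy /=.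
    by apply/hasP; exists s' => //; apply/hasP; exists s => //; rewrite eS.
  apply: (@no_bad_orientation X G (fun x => x.1) touch bad m M) => //.
  - move=> x y /andP[xy /hasP[s sL /hasP[s' sL' /andP[_ h]]]]; rewrite /touch xy.
    by apply/hasP; exists s => //; apply/hasP; exists s'.
  - move=> x y txy; have /existsPn/(_ y) := H x; rewrite txy /=.
    by case: (bad x y); case: (bad y x).
  - exact: bad_cover.
  - exact: few_removed.
case/existsP=> -[g t] /existsP[[g' t']] /and3P[/andP[/= gg /hasP[s sL /hasP[s' sL' h]]] nb1 nb2].
have c1 a b : a \in L g -> b \in L g' -> e (Phi g t a) (Phi g' t' b) ->
    [/\ a == [::], b == [::], en g g' & en g' g].
  move=> aL bL eab.
  have : (b == [::]) && en g g'.
    apply: contraR nb1 => nb; rewrite /bad /= gg; apply/hasP; exists a => //.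
    by apply/hasP; exists b => //; rewrite nb.
  have : (a == [::]) && en g' g.
    apply: contraR nb2 => nb; rewrite /bad /= eq_sym gg; apply/hasP; exists b => //.
    by apply/hasP; exists a => //; rewrite nb /V /= eS.
  by case/andP=> -> -> /andP[-> ->].
have [/eqP s0 /eqP s0' e1 e2] := c1 s s' sL sL' h.
exists g, g', t, t'; split=> //; first by rewrite /V s0 s0' in h.
move=> a b aL bL; apply/idP/andP; first by move/c1 => /(_ aL bL)[].
by case=> /eqP-> /eqP->; rewrite /V s0 s0' in h.
Qed.

End Families.
End Core.

(** * Placing the families *)

Definition rooted (right : bool) (L : seq (seq nat)) (beta : seq nat -> int) :=
  {in L, forall s, s != [::] -> (if right then beta s < beta [::] else beta [::] < beta s)%R}.

Section Rank.
Variables (beta : seq nat -> int) (L : seq (seq nat)).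

Definition rank s := count (fun t => beta t < beta s)%R L.

Lemma rank_lt s t : s \in L -> (beta s < beta t)%R -> rank s < rank t.
Proof.
move=> sL st; rewrite /rank !(permP (perm_to_rem sL)) /= ltxx st add0n add1n ltnS.
by apply: sub_count => u /= us; exact: lt_trans us st.
Qed.

Lemma rank_size s : s \in L -> rank s < size L.
Proof.
move=> sL; rewrite /rank (permP (perm_to_rem sL)) (perm_size (perm_to_rem sL)) /= ltxx add0n ltnS.
exact: count_size.
Qed.

Lemma rank_root_left : rooted false L beta -> rank [::] = 0.
Proof.
move=> H; apply/eqP; rewrite -leqn0 leqNgt -has_count; apply/negP=> /hasP[t tL].
case: (eqVneq t [::]) => [->|/(H t tL) h1 h2]; first by rewrite ltxx.
by have := lt_trans h1 h2; rewrite ltxx.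
Qed.

Lemma rank_root_right : uniq L -> [::] \in L -> rooted true L beta -> (rank [::]).+1 = size L.
Proof.
move=> uL nL H; rewrite /rank (permP (perm_to_rem nL)) (perm_size (perm_to_rem nL)) /= ltxx add0n.
congr _.+1; apply/eqP; rewrite -all_count; apply/allP=> t.
by rewrite mem_rem_uniq // inE => /andP[t0 tL]; exact: H.
Qed.

End Rank.

(* The slots of the four families, named by (side, inner).  From left to right: a spare slot [0],
   the roots of the outer and of the inner left-rooted family, the other vertices of the four
   families, the roots of the inner and of the outer right-rooted family, a spare slot. *)
Definition slot (tau : nat) (g : bool * bool) (k r : nat) : nat :=
  match g with
  | (false, false) => if r == 0 then 1 else 2 + r
  | (false, true) => if r == 0 then 2 else tau + 2 + r
  | (true, true) => if r.+1 == k then 4 * tau + 2 else 2 * tau + 2 + r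
  | (true, false) => if r.+1 == k then 4 * tau + 3 else 3 * tau + 2 + r
  end.

(* [extreme g g']: the root of [g'] is the first or the last among the slots not used by [g]. *)
Definition extreme (g g' : bool * bool) := if g.1 == g'.1 then g.2 != g'.2 else ~~ g'.2.

(** Where [g] itself owns the outermost root, the inner family on that side takes over. This is why
    each side carries two families. *)
Definition first_root (g : bool * bool) := if g == (false, false) then (false, true) else (false, false).
Definition last_root (g : bool * bool) := if g == (true, false) then (true, true) else (true, false).

(* The slots of the root ([root = true]) and of the other vertices of a family. *)
Definition zone (tau : nat) (g : bool * bool) (root : bool) (n : nat) : bool :=
  match g with
  | (false, false) => if root then n == 1 else 2 < n < tau + 2
  | (false, true) => if root then n == 2 else tau + 2 < n < 2 * tau + 2
  | (true, true) => if root then n == 4 * tau + 2 else 2 * tau + 2 <= n < 3 * tau + 2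
  | (true, false) => if root then n == 4 * tau + 3 else 3 * tau + 2 <= n < 4 * tau + 2
  end.

Lemma zone_slot tau g k r (root : bool) : k < tau -> r < k ->
  root = (if g.1 then r.+1 == k else r == 0) -> zone tau g root (slot tau g k r).
Proof.
by case: g => -[] [] kt rk /= ->; rewrite /zone /slot; case: eqP; lia.
Qed.

Lemma slot_mono tau g k r r' : k < tau -> r < r' -> r' < k -> slot tau g k r < slot tau g k r'.
Proof. by case: g => -[] [] kt rr rk; rewrite /slot; do 2!case: eqP; lia. Qed.

Lemma zone_bounds tau g r n : 1 < tau -> zone tau g r n -> 0 < n < 4 * tau + 4.
Proof. by move=> tau1; case: g; case; case; case: r => /=; lia. Qed.

Lemma zone_disjoint tau g g' r r' n n' : 1 < tau -> g != g' -> zone tau g r n -> zone tau g' r' n' -> n != n'.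
Proof. by move=> tau1; case: g => -[] []; case: g' => -[] [] //= _; case: r; case: r' => /=; lia. Qed.

Lemma zone_between tau g g' r' n1 n' n3 : 1 < tau -> g' != g -> ~~ (r' && extreme g g') ->
  zone tau (first_root g) true n1 -> zone tau g' r' n' -> zone tau (last_root g) true n3 ->
  n1 < n' < n3.
Proof. by move=> tau1; case: g => -[] []; case: g' => -[] [] //= _; case: r' => //=; lia. Qed.

(** Only outer families get extended: their root lies beyond all other slots on its side, so it is
    still extreme after a branch from any other family is added. *)
Lemma zone_outer tau g g' r n n' : 1 < tau -> ~~ g.2 -> (g != g') || ~~ r ->
  zone tau g true n -> zone tau g' r n' -> if g.1 then n' < n else n < n'.
Proof. by move=> tau1; case: g => -[] [] // _; case: g' => -[] [] //=; case: r => //=; lia. Qed.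

(** * Growing one of the two trees, and iterating *)

Section Step.
Variables (R : realFieldType) (T : finType) (e : rel T) (d h : nat) (lam eps : R)
  (I : seq int) (B : int -> {set T}).
Local Open Scope ring_scope.
Hypotheses (simple : simple_graph e) (d2 : (2 <= d)%N) (lam0 : 0 < lam)
  (lam_small : lam <= ((2 : R) ^+ (9 * d))^-1 / (d%:R ^+ (1 + h)))
  (coh : coherent e eps) (blk : blockade I B) (eqc : equicardinal I B)
  (szI : (6 * d ^ (h + 2) <= size I)%N)
  (wid : (2 : R) ^+ (9 * d) * eps * #|T|%:R <= (width I B)%:R)
  (conc : concave e lam I B) (unif : support_uniform e (d ^ (1 + h)) I B)
  (inv : support_invariant e (((2 : R) ^+ (9 * d))^-1) (d ^ (1 + h)) I B).

Let tau := (d ^ (1 + h))%N.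
Let K := (2 ^ (9 * d))%N.

Let K_ge : (1000 <= K)%N.
Proof. by apply: (@leq_trans (2 ^ 18)); rewrite // leq_exp2l //; lia. Qed.

Let tau_ge : (2 <= tau)%N.
Proof. by rewrite /tau add1n expnS; have : (0 < d ^ h)%N; [rewrite expn_gt0; lia | nia]. Qed.

(** The slots run from [0] to [4 * tau + 4], both spare ones included. *)
Let I_ge : (4 * tau + 5 <= size I)%N.
Proof.
apply: leq_trans szI; rewrite addn2 expnS; move: tau_ge; rewrite /tau add1n.
by move: (d ^ h.+1)%N => t; nia.
Qed.

Let p n := nth 0 (sort <=%O I) n.

Let p_in n : (n < size I)%N -> p n \in I.
Proof. by move=> nI; rewrite -(mem_sort <=%O) mem_nth // size_sort. Qed.

Let p_lt n m : (n < size I)%N -> (m < size I)%N -> (p n < p m) = (n < m)%N.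
Proof.
move=> nI mI; apply: (@lt_sorted_ltn_nth _ _ 0); rewrite ?inE ?size_sort //.
by rewrite sort_lt_sorted; case: blk.
Qed.

Definition realizes (right : bool) (a : nat) :=
  exists phi beta, rainbow e I B (Slist d h a) phi beta /\ rooted right (Slist d h a) beta.

Let w0 : (0 < width I B)%N.
Proof.
case: blk => _ [ne _].
have [i iI] : exists i, i \in I by exists (p 0); apply: p_in; lia.
by rewrite (width_in eqc iI) card_gt0 ne.
Qed.

Lemma realizes0 right : realizes right 0.
Proof.
have iI : p 0 \in I by apply: p_in; lia.
case: blk => _ [ne _]; have /set0Pn[v vB] := ne _ iI.
exists (fun=> v), (fun=> p 0); split; last by move=> s /Slist0->.
split=> //; first by move=> s t /Slist0-> /Slist0->.
by move=> s t /Slist0-> /Slist0->; rewrite simple.2 adj_irr.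
Qed.

(** Of the two copies joined at their roots, the one of the lower level takes the other as its new
    branch. *)
Lemma realizes_succ a b : (a < d * h)%N -> (b < d * h)%N ->
  realizes false a -> realizes true b -> realizes false a.+1 \/ realizes true b.+1.
Proof.
move=> ah bh [phia [betaa [Ra roota]]] [phib [betab [Rb rootb]]].
pose lev (g : bool * bool) := if g.1 then b else a.
pose L g := Slist d h (lev g).
pose phi0 (g : bool * bool) := if g.1 then phib else phia.
pose beta0 (g : bool * bool) := if g.1 then betab else betaa.
have Rg g : rainbow e I B (L g) (phi0 g) (beta0 g) by rewrite /L /lev /phi0 /beta0; case: g.1.
have rootg g : rooted g.1 (L g) (beta0 g) by rewrite /L /lev /beta0; case: g.1.
have levh g : (lev g < d * h)%N by rewrite /lev; case: g.1.
have nilL g : [::] \in L g by exact: nil_Slist.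
have szL g : (size (L g) < tau)%N by rewrite /tau add1n; exact: size_Slist.
pose rk g s := rank (beta0 g) (L g) s.
have rkS g s : s \in L g -> (rk g s < size (L g))%N by exact: rank_size.
have rkl g s t : s \in L g -> beta0 g s < beta0 g t -> (rk g s < rk g t)%N by exact: rank_lt.
have rk0 g : if g.1 then (rk g [::]).+1 = size (L g) else rk g [::] = 0%N.
  have := rootg g; case: g.1 => H; last exact: rank_root_left.
  by apply: rank_root_right => //; exact: uniq_Slist.
have rkn g s : s \in L g -> s != [::] -> if g.1 then ((rk g s).+1 < size (L g))%N else (0 < rk g s)%N.
  move=> sL s0; have := rk0 g; have := rootg g s sL s0; case: (g.1) => H E.
    by rewrite -E ltnS; exact: rkl.
  by rewrite -E; exact: rkl.
(* The slot depends on [s] only through its rank in the given copy, so the new placement keeps the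
   order ([mono]) and the copy can be transferred. *)
pose sl g s := slot tau g (size (L g)) (rk g s).
pose beta g s := p (sl g s).
have slZ g s : s \in L g -> zone tau g (s == [::]) (sl g s).
  move=> sL; apply: zone_slot (szL g) (rkS g s sL) _.
  case: eqVneq => [->|s0]; first by have := rk0 g; case: g.1 => ->; rewrite eqxx.
  by have := rkn g s sL s0; case: g.1 => H; apply/esym/negbTE; rewrite ?neq_ltn ?H // -lt0n.
have slI g s : s \in L g -> (0 < sl g s < 4 * tau + 4)%N by move/slZ; exact: zone_bounds tau_ge.
have slI' g s : s \in L g -> (sl g s < size I)%N.
  by move=> /slI/andP[_ H]; apply: leq_trans I_ge; lia.
have betaI g s : s \in L g -> beta g s \in I by move/slI'/p_in.
have blt g g' s s' : s \in L g -> s' \in L g' -> (beta g s < beta g' s') = (sl g s < sl g' s')%N.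
  by move=> sL sL'; rewrite /beta p_lt ?slI'.
have sl_lt g s t : s \in L g -> t \in L g -> beta0 g s < beta0 g t -> (sl g s < sl g t)%N.
  by move=> sL tL st; apply: slot_mono (szL g) (rkl g s t sL st) (rkS g t tL).
have mono g : {in L g &, forall s t, (beta0 g s < beta0 g t) = (beta g s < beta g t)}.
  move=> s t sL tL; rewrite blt //.
  case: (ltgtP (beta0 g s) (beta0 g t)) => [/(sl_lt g s t sL tL)->//|/(sl_lt g t s tL sL) H|E].
    by apply/esym/negbTE; rewrite -leqNgt ltnW.
  by case: (Rg g) => _ inj _; rewrite (inj s t sL tL E) ltnn.
have K0 : (0 : R) < K%:R by rewrite ltr0n; move: K_ge; lia.
have KE : (2 : R) ^+ (9 * d) = K%:R by rewrite /K natrX.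
have k2 : ((2 : R) ^+ (9 * d))^-1 <= 2^-1.
  by rewrite KE lef_pV2 ?posrE ?ltr0n ?ler_nat; move: K_ge; lia.
have famP g : exists Phi : nat -> seq nat -> T,
    (forall t, (t < uphalf (width I B))%N -> rainbow e I B (L g) (Phi t) (beta g)) /\
    (forall t t' s, (t < uphalf (width I B))%N -> (t' < uphalf (width I B))%N ->
        s \in L g -> Phi t s = Phi t' s -> t = t').
  apply: (disjoint_copies simple.2 eqc k2 w0 unif inv _ (Rg g)) => //.
  - exact: ltnW (szL g).
  - by move=> s /betaI.
  - exact: mono.
have [Phi PhiP] := fin_all_exists famP.
have betaD g g' s s' : g != g' -> s \in L g -> s' \in L g' -> beta g s != beta g' s'.
  move=> gg sL sL'; have := zone_disjoint tau_ge gg (slZ g s sL) (slZ g' s' sL').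
  by case: (ltngtP (sl g s) (sl g' s')) => // H _; [rewrite lt_eqF // blt|rewrite gt_eqF // blt].
have [g [g' [t [t' [gg [tN tN'] [ext ext'] eroot cross]]]]] :
  exists g g' t t', [/\ g != g', (t < uphalf (width I B))%N /\ (t' < uphalf (width I B))%N,
   extreme g g' /\ extreme g' g, e (Phi g t [::]) (Phi g' t' [::]) &
   {in L g & L g', forall s s', e (Phi g t s) (Phi g' t' s') = (s == [::]) && (s' == [::])}].
  apply: (@root_root_pair R T e I B lam eps K tau simple.1 coh blk eqc conc w0 K_ge _ _ _ lam0
    _ L extreme first_root last_root beta Phi (p 0) (p (4 * tau + 4)%N) (false, false)).
  - by move: tau_ge; lia.
  - by rewrite mulrA -KE.
  - rewrite natrM /tau natrX -KE -ler_pdivlMr; last first.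
      by rewrite mulr_gt0 ?exprn_gt0 ?ltr0n //; lia.
    by rewrite mul1r invfM.
  - by rewrite card_prod card_bool.
  - exact: nilL.
  - by move=> g; exact: ltnW (szL g).
  - exact: betaI.
  - by move=> g t s tN sL; case: ((PhiP g).1 t tN) => /(_ s sL)[].
  - by move=> g t t' s tN tN' sL; exact: (PhiP g).2.
  - exact: betaD.
  - by case=> -[] [].
  - by case=> -[] [].
  - move=> g g' s' gg sL' nb; rewrite !blt //.
    exact: zone_between tau_ge gg nb (slZ _ _ (nilL _)) (slZ _ _ sL') (slZ _ _ (nilL _)).
  - by apply: p_in; move: I_ge; lia.
  - by apply: p_in; move: I_ge; lia.
  - move=> g s sL; have := slI g s sL; have := slI' g s sL => h1 /andP[h2 h3].
    by rewrite /beta !p_lt ?h2 ?h3 //; move: I_ge; lia.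
have join g1 g2 t1 t2 : ~~ g1.2 -> g1 != g2 -> (lev g1 <= lev g2)%N ->
    (t1 < uphalf (width I B))%N -> (t2 < uphalf (width I B))%N ->
    {in L g1 & L g2, forall s s', e (Phi g1 t1 s) (Phi g2 t2 s') = (s == [::]) && (s' == [::])} ->
    realizes g1.1 (lev g1).+1.
  move=> g12 gne gle tN1 tN2 cr.
  have [|phi [bet [H1 H2 H3]]] := rainbow_join simple.1 d2 gle (levh g1) (ltnW (levh g2))
    ((PhiP g1).1 t1 tN1) ((PhiP g2).1 t2 tN2) _ cr.
    by move=> s s' sL sL'; apply/eqP; exact: betaD.
  exists phi, bet; split=> // s sL s0; rewrite H2.
  have out g3 u : u \in L g3 -> (g1 != g3) || (u != [::]) ->
      if g1.1 then beta g3 u < beta g1 [::] else beta g1 [::] < beta g3 u.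
    move=> uL H; rewrite !blt //.
    exact: zone_outer tau_ge g12 H (slZ _ _ (nilL g1)) (slZ _ _ uL).
  case: (H3 s sL s0) => [[u uL /andP[u0 /eqP->]]|[u uL /eqP->]]; apply: out => //.
    by rewrite u0 orbT.
  by rewrite gne.
have cross' : {in L g' & L g, forall s s', e (Phi g' t' s) (Phi g t s') = (s == [::]) && (s' == [::])}.
  by move=> s s' sL sL'; rewrite simple.1 cross // andbC.
have gg' : g' != g by rewrite eq_sym.
have succ g1 : realizes g1.1 (lev g1).+1 -> realizes false a.+1 \/ realizes true b.+1.
  by rewrite /lev; case: g1.1; [right|left].
(* Mutually extreme families are either both outer, on opposite sides, or the outer and inner family
   of one side. In the second case the levels agree, so the outer one may be chosen for growth. *)
have dir g1 g2 : extreme g1 g2 -> extreme g2 g1 -> ~~ g1.2 \/ ~~ g2.2 /\ lev g2 = lev g1.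
  by case: g1 => -[] []; case: g2 => -[] [] //=; auto.
case: (leqP (lev g) (lev g')) => le.
  case: (dir _ _ ext ext') => [g2|[g2 E]]; first exact: succ (join _ _ _ _ g2 gg le tN tN' cross).
  by apply: succ (join _ _ _ _ g2 gg' _ tN' tN cross'); rewrite E.
case: (dir _ _ ext' ext) => [g2|[g2 E]]; first exact: succ (join _ _ _ _ g2 gg' (ltnW le) tN' tN cross').
by rewrite E ltnn in le.
Qed.

Lemma realizes_contains right : realizes right (d * h) -> contains_T e d h.
Proof.
move=> [phi [beta [[H1 H2 H3] _]]].
pose word (u : Tvert d h) : seq nat := map val (tagged u).
have wordL u : word u \in Slist d h (d * h).
  apply: Slist_full; last by rewrite size_map size_tuple -ltnS.
  by apply/allP=> _ /mapP[i _ ->]; exact: ltn_ord.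
exists (fun u => phi (word u)); split; last first.
  move=> x y; rewrite H3 // /adj /Tadj.
  have C u v : child (word u) (word v) = Tchild u v.
    by rewrite /child /Tchild /word !size_map -map_take (inj_eq (inj_map val_inj)).
  by rewrite !C.
(* Equal images lie in one block, so injectivity of [beta] makes the words equal. *)
move=> x y E.
have [xI xB] := H1 _ (wordL x); have [yI yB] := H1 _ (wordL y).
rewrite -E in yB; have := H2 _ _ (wordL x) (wordL y) (block_eq blk xI yI xB yB).
move/(inj_map val_inj); case: x y {E xI xB yI yB} => [i x] [j y] /= xy.
have ij : i = j by apply: val_inj; rewrite /= -(size_tuple x) xy size_tuple.
by case: _ / ij y xy => y /val_inj->.
Qed.

(** [n] bounds the steps still possible: each raises [a + b] by one, and the process ends once [a]
    or [b] equals [d * h]. *)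
Lemma realizes_iter n a b : (2 * (d * h) <= a + b + n)%N -> (a <= d * h)%N -> (b <= d * h)%N ->
  realizes false a -> realizes true b -> contains_T e d h.
Proof.
elim: n a b => [|n IH] a b ab; rewrite leq_eqVlt => /orP[/eqP->|ah];
  rewrite leq_eqVlt => /orP[/eqP->|bh] Ra Rb; try exact: realizes_contains Ra;
  try exact: realizes_contains Rb; first by lia.
case: (realizes_succ ah bh Ra Rb) => Rs.
  by apply: IH Rs Rb; lia.
by apply: IH Ra Rs; lia.
Qed.

End Step.

Local Open Scope ring_scope.

Theorem theorem3p1 (R : realFieldType) (T : finType) (e : rel T) (d h : nat)
  (lam eps : R) (I : seq int) (B : int -> {set T}) :
  simple_graph e ->
  (2 <= d)%N ->
  0 < lam -> lam <= ((2 : R) ^+ (9 * d))^-1 / (d%:R ^+ (1 + h)) ->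
  0 < eps ->
  coherent e eps ->
  blockade I B -> equicardinal I B ->
  (6 * d ^ (h + 2) <= size I)%N ->
  (2 : R) ^+ (9 * d) * eps * #|T|%:R <= (width I B)%:R ->
  concave e lam I B ->
  support_uniform e (d ^ (1 + h)) I B ->
  support_invariant e (((2 : R) ^+ (9 * d))^-1) (d ^ (1 + h)) I B ->
  contains_T e d h.
Proof.
move=> simple d2 lam0 lam_small _ coh blk eqc szI wid conc unif inv.
apply: (realizes_iter simple d2 lam0 lam_small coh blk eqc szI wid conc unif inv
  (n := 2 * (d * h)) (a := 0) (b := 0)) => //;
  exact: realizes0 simple d2 lam0 lam_small blk eqc szI wid _.
Qed.
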